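(* Let $\mu>0$ and let $h_1,h_2$ be intensity functions with $\int_0^\infty h_i(y)\,dy=\infty$ and for which the limits $\lim_{x\to\infty}\frac{xh_i'(x)}{h_i(x)}$ exist ($i=1,2$). If there exists $M>0$ such that on $[M,\infty)$ the functions $h_1,h_2$ are monotonic and $h_1(x)\le h_2(x)$ for all $x\ge M$, then $$\lim_{x_e\to \infty}PoA(h_1, x_e)\leq\lim_{x_e\to \infty}PoA(h_2, x_e).$$
   Context: Fix $\mu>0$ (service rate) and $c_t>0$ (travel cost per unit distance). An intensity function is a nonnegative measurable function $h$ on $[0,\infty)$ such that $\lambda(x)=\int_0^x h(y)\,dy$ is finite for all $x\ge 0$. In the M/G/1/1 loss system, customers with distance less than $x$ from the server arrive as a Poisson process of rate $\lambda(x)$; a customer joins only if the server is idle and his distance is at most the threshold in use. The service value is $R$, the waiting cost per unit time is $c_w$, and $x_e=\frac{R\mu-c_w}{c_t\mu}>0$ is the Nash equilibrium threshold (treated as a positive parameter, with $\mu$ and $h$ fixed). The expected social benefit per unit time with threshold $x\ge 0$ is $$S(x)=\frac{c_t\int_0^x (x_e-y)h(y)\,dy}{1+\frac1\mu\int_0^x h(y)\,dy}.$$ The socially optimal threshold $x^*$ (which maximizes $S$ over $x\ge0$) is the unique $x\ge 0$ satisfying $x_e=\frac1\mu\int_0^{x}(x-y)h(y)\,dy+x$; it depends on $x_e$, $h$ and $\mu$. The price of anarchy is $$PoA(h,x_e)=\frac{S(x^* )}{S(x_e)}=\frac{\int_{0}^{x^*} (x_e-y)h(y)\,dy}{\int_{0}^{x_e}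 (x_e-y)h(y)\,dy}\cdot\frac{1+\frac{1}{\mu} \int_{0}^{x_e} h(y)\,dy}{1+\frac{1}{\mu} \int_{0}^{x^*} h(y)\,dy}$$ (defined whenever $\int_0^{x_e}h(y)\,dy>0$; $c_t$ cancels). Existence of $\lim_{x\to\infty} xh_i'(x)/h_i(x)$ includes that $h_i$ is differentiable and nonzero for all sufficiently large $x$. Limits are allowed to equal $+\infty$. The two functions need not be monotonic in the same direction. *)

(* Defs.v *)
From HB Require Import structures.
From mathcomp Require Import all_boot all_order all_algebra.
From mathcomp Require Import all_classical all_reals all_analysis.
Import Order.TTheory GRing.Theory Num.Theory.
Import numFieldNormedType.Exports.

Set Implicit Arguments.
Unset Strict Implicit.
Unset Printing Implicit Defensive.

Local Open Scope classical_set_scope.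
Local Open Scope ring_scope.

Section loss_system.
Context {R : realType}.
Implicit Types (h : R -> R) (mu ct xe x y M : R).

(* An intensity is a function on [0, +oo[; it is represented by a total
   function whose values on the negative reals are irrelevant. *)
Definition intensity h : Prop :=
  [/\ measurable_fun (`[0, +oo[ : set R) h,
      (forall x, 0 <= x -> 0 <= h x) &
      (forall x, 0 <= x ->
         (\int[lebesgue_measure]_(y in `[0%R, x]) (h y)%:E < +oo)%E)].

Definition arrival_rate h x : R := \int[lebesgue_measure]_(y in `[0, x]) h y.

Definition social_benefit mu ct h xe x : R :=
  ct * (\int[lebesgue_measure]_(y in `[0, x]) ((xe - y) * h y))
  / (1 + mu^-1 * arrival_rate h x).

Definition is_opt_threshold mu h xe x : Prop :=
  0 <= x /\
  xe = mu^-1 * (\int[lebesgue_measure]_(y in `[0, x]) ((x - y) * h y)) + x.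

(* For 0 < mu, 0 < xe and h an intensity, the right-hand side of the equation
   above is continuous and strictly increasing in x, vanishes at 0 and tends to
   +oo, so there is exactly one such threshold and the default 0 is not used. *)
Definition opt_threshold mu h xe : R := xget 0 [set x | is_opt_threshold mu h xe x].

Definition PoA mu ct h xe : R :=
  social_benefit mu ct h xe (opt_threshold mu h xe)
  / social_benefit mu ct h xe xe.

(* The limit of x h'(x) / h(x) at +oo exists in the extended reals; derive1 and
   division are total, hence the explicit differentiability and h x != 0. *)
Definition has_elasticity_limit h : Prop :=
  (\forall x \near +oo, derivable h x 1 /\ h x != 0) /\
  (exists l : \bar R, (x * h^`()%classic x / h x)%:E @[x --> +oo] --> l).

Definition monotonic_from M h : Prop :=
  (forall x y, M <= x -> x <= y -> h x <= h y) \/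
  (forall x y, M <= x -> x <= y -> h y <= h x).

End loss_system.

(* Main.v *)
(** Write L for the arrival rate and P(x) = int_0^x (x - y) h(y) dy, so that
P' = L where h is continuous.  The equation x_e = P(x* )/mu + x* collapses
S(x* ) to c_t P(x* ), whence PoA = (1 - x*/x_e) * x_e (mu + L(x_e)) / P(x_e).
Since L tends to +oo, P is superlinear, and x*/x_e tends to 0.  If x h'/h tends
to l, comparing derivatives gives x h ~ (1 + l) L and then x L ~ (2 + l) P up to
affine terms, which P absorbs: PoA tends to l + 2.  Finally h1 <= h2 forces
l1 <= l2, for otherwise ln h1 - ln h2 - e ln x would be eventually
nondecreasing for some e > 0, while ln x is unbounded. *)

Require Import Defs.
From HB Require Import structures.
From mathcomp Require Import all_boot all_order all_algebra.
From mathcomp Require Import all_classical all_reals all_analysis.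
From mathcomp Require Import measurable_realfun.
From mathcomp Require Import ring lra.
Import Order.TTheory GRing.Theory Num.Theory.
Import numFieldNormedType.Exports.

Local Open Scope classical_set_scope.
Local Open Scope ring_scope.

(** * Comparing functions near [+oo] through their derivatives, and limits in the extended reals *)

Section real_analysis.
Context {R : realType}.
Implicit Types (f g df dg : R -> R) (l : \bar R).

(** The mean value theorem makes [g - f] nondecreasing from some point on, and [C] absorbs its value
    there. This one-sided form stands in for l'Hopital's rule and treats finite and infinite limits
    alike. *)
Lemma derive_le_near f g df dg :
  (\forall x \near +oo, is_derive (x : R) 1 f (df x)) ->
  (\forall x \near +oo, is_derive (x : R) 1 g (dg x)) ->
  (\forall x \near +oo, df x <= dg x) ->
  exists C, \forall x \near +oo, f x <= g x + C.
Proof.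
move=> fdf gdg dfg.
have [N [_ HN]] : \forall x \near +oo,
    is_derive (x : R) 1 (g - f) (dg x - df x) /\ df x <= dg x.
  near=> x; split; last by near: x.
  by apply: is_deriveB; near: x.
(* The hypotheses hold only strictly beyond [N], so the closed segment for the mean value theorem
   starts at [N + 1]. *)
exists (f (N + 1) - g (N + 1)); near=> x.
have N1x : N + 1 <= x by near: x; apply: nbhs_pinfty_ge; exact: num_real.
have [z | | c] := @MVT_segment _ (g - f) (fun x => dg x - df x) _ _ N1x.
- rewrite in_itv/= => /andP[N1z _].
  by have /HN[] : N < z by lra.
- apply: derivable_within_continuous => z; rewrite in_itv/= => /andP[N1z _].
  by have /HN[[]] : N < z by lra.
rewrite in_itv/= => /andP[Nc _] E.
have : 0 <= (dg c - df c) * (x - (N + 1)).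
  by rewrite mulr_ge0 ?subr_ge0//; have /HN[] : N < c by lra.
by rewrite -E !fctE; lra.
Unshelve. all: by end_near. Qed.

(** Leaves a positive real gap [b - c] that can be spent on error terms, even when [l] is
    infinite. *)
Lemma ereal_between l (b : R) : (l < b%:E)%E ->
  exists2 c : R, (l < c%:E)%E & c < b.
Proof.
case: l => [l|//|_]; last by exists (b - 1); rewrite ?ltNyr//; lra.
by rewrite lte_fin => lb; exists ((l + b) / 2); rewrite ?lte_fin; lra.
Qed.

Lemma ereal_between' l (b : R) : (b%:E < l)%E ->
  exists2 c : R, (c%:E < l)%E & b < c.
Proof.
case: l => [l|_|//]; last by exists (b + 1); rewrite ?ltry//; lra.
by rewrite lte_fin => lb; exists ((l + b) / 2); rewrite ?lte_fin; lra.
Qed.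

(** Real bounds on either side handle all limits uniformly: the first premise is vacuous for [+oo],
    the second for [-oo]. *)
Lemma cvg_ereal_order (T : Type) (F : set_system T) (FF : Filter F)
    (f : T -> R) l :
  (forall b : R, (l < b%:E)%E -> \forall x \near F, f x <= b) ->
  (forall a : R, (a%:E < l)%E -> \forall x \near F, a <= f x) ->
  (f x)%:E @[x --> F] --> l.
Proof.
case: l => [l||] ub lb.
- apply: cvg_EFin; first exact: nearW.
  apply/cvgrPdist_le => e e0; near=> x; rewrite /= ler_distlC.
  apply/andP; split; near: x; [apply: lb|apply: ub]; rewrite lte_fin; lra.
- apply: (cvgeyPge _).2 => A; apply: (filterS _ (lb A (ltry _))) => x; rewrite lee_fin; exact.
- apply: (cvgeNyPle _).2 => A; apply: (filterS _ (ub A (ltNyr _))) => x; rewrite lee_fin; exact.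
Unshelve. all: by end_near. Qed.

Lemma cvg_ereal_le_near (T : Type) (F : set_system T) (FF : Filter F)
    (f : T -> R) l (b : R) : (f x)%:E @[x --> F] --> l -> (l < b%:E)%E ->
  \forall x \near F, f x <= b.
Proof.
move=> fl lb; have := fl [set u | u < b%:E]%E (open_ereal_lt' lb).
by apply: (filterS (F := F)) => x /=; rewrite lte_fin => /ltW.
Qed.

Lemma cvg_ereal_ge_near (T : Type) (F : set_system T) (FF : Filter F)
    (f : T -> R) l (a : R) : (f x)%:E @[x --> F] --> l -> (a%:E < l)%E ->
  \forall x \near F, a <= f x.
Proof.
move=> fl al; have := fl [set u | a%:E < u]%E (open_ereal_gt' al).
by apply: (filterS (F := F)) => x /=; rewrite lte_fin => /ltW.
Qed.

End real_analysis.

(** * The arrival rate and its antiderivative *)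

Section intensity.
Context {R : realType}.
Notation leb := (@lebesgue_measure R).
Variable h : R -> R.
Hypothesis h_int : intensity h.

Let h_ge0 x : 0 <= x -> 0 <= h x. Proof. by case: h_int => _ + _; exact. Qed.

Lemma integrable_intensity x : leb.-integrable `[0, x] (EFin \o h).
Proof.
case: h_int => mh h0 hoo.
have mhx : measurable_fun `[0, x] h.
  by apply: measurable_funS mh => //; exact: subset_itvl.
apply/integrableP; split; first exact/measurable_EFinP.
have [x0|x0] := leP 0 x; last by rewrite set_itv_ge ?integral_set0// bnd_simp -ltNge.
apply: le_lt_trans (hoo _ x0); rewrite le_eqVlt; apply/orP; left; apply/eqP.
apply: eq_integral => y.
by rewrite inE/= in_itv/= => /andP[y0 _]; rewrite ger0_norm ?h0.
Qed.

Definition first_moment (x : R) : R := \int[leb]_(y in `[0, x]) (y * h y).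

(** On [[0, x]] the integrand is dominated by [x * h y]. *)
Lemma integrable_first_moment x :
  leb.-integrable `[0, x] (EFin \o (fun y => y * h y)).
Proof.
have ih := integrable_intensity x.
apply: (@le_integrable _ _ _ leb _ _ _ (fun y => x%:E * (EFin \o h) y)%E) => //.
- apply/measurable_EFinP/measurable_funM => //.
  by case/integrableP : ih => /measurable_EFinP.
- move=> y /=; rewrite in_itv/= => /andP[y0 yx].
  rewrite lee_fin !ger0_norm ?mulr_ge0 ?h_ge0 ?(le_trans y0)//.
  by rewrite ler_wpM2r ?h_ge0.
- exact: integrableZl.
Qed.

(* Equals int_0^x (x - y) h(y) dy, by Rintegral_affine_intensity, and is an
   antiderivative of the arrival rate wherever h is continuous. *)
Definition double_rate x := x * arrival_rate h x - first_moment x.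

(** [z] is kept apart from [x] to serve both the threshold equation, where [z] is the threshold, and
    the social benefit, where [z] is [xe]. *)
Lemma Rintegral_affine_intensity z x :
  \int[leb]_(y in `[0, x]) ((z - y) * h y)
  = z * arrival_rate h x - first_moment x.
Proof.
have ih := integrable_intensity x; have im := integrable_first_moment x.
under eq_Rintegral do rewrite mulrBl.
rewrite RintegralB//; last exact: (@integrableZl _ _ _ leb _ _ z _ ih).
by rewrite RintegralZl.
Qed.

Lemma double_rate_ge0 x : 0 <= double_rate x.
Proof.
rewrite /double_rate -Rintegral_affine_intensity; apply: Rintegral_ge0 => y /=.
by rewrite in_itv/= => /andP[y0 yx]; rewrite mulr_ge0 ?h_ge0// subr_ge0.
Qed.

Lemma arrival_rate_ge0 x : 0 <= arrival_rate h x.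
Proof.
by apply: Rintegral_ge0 => y /=; rewrite in_itv/= => /andP[y0 _]; exact: h_ge0.
Qed.

Lemma arrival_rate_nondecreasing x y : x <= y ->
  arrival_rate h x <= arrival_rate h y.
Proof.
move=> xy; have ih z := integrable_intensity z.
rewrite /arrival_rate /Rintegral fine_le//; [exact: integrable_fin_num..|].
apply: ge0_subset_integral => //.
- by case/integrableP : (ih y).
- by move=> z /=; rewrite in_itv/= lee_fin => /andP[z0 _]; exact: h_ge0.
- exact: subset_itvl.
Qed.

Lemma is_derive_arrival_rate x : 0 < x -> {for x, continuous h} ->
  is_derive x 1 (arrival_rate h) (h x).
Proof.
(* Integrating up to [x + 1] makes [x] an interior point for the fundamental theorem of calculus. *)
move=> x0 hx; have x1 : x < x + 1 by rewrite ltrDl.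
have [dF <-] := continuous_FTC1_closed x1 (integrable_intensity _) x0 hx.
by rewrite derive1E; exact/derivableP.
Qed.

Lemma is_derive_first_moment x : 0 < x -> {for x, continuous h} ->
  is_derive x 1 first_moment (x * h x).
Proof.
move=> x0 hx; have x1 : x < x + 1 by rewrite ltrDl.
have mx : {for x, continuous (fun y : R => y * h y)} by apply: cvgM => //; exact: cvg_id.
have [dF <-] := continuous_FTC1_closed x1 (integrable_first_moment _) x0 mx.
by rewrite derive1E; exact/derivableP.
Qed.

Lemma is_derive_double_rate x : 0 < x -> {for x, continuous h} ->
  is_derive x 1 double_rate (arrival_rate h x).
Proof.
move=> x0 hx; have dL := is_derive_arrival_rate _ x0 hx.
have dG := is_derive_first_moment _ x0 hx.
have -> : double_rate = (id * arrival_rate h - first_moment)%R by [].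
apply: (is_derive_eq (is_deriveB (is_deriveM (is_derive_id _ _) dL) dG)).
by rewrite -[x *: _]/(x * _) -[_ *: 1]/(_ * 1); ring.
Qed.

(** Integrals depend continuously on their endpoint, so this holds down to 0 and where [h] jumps;
    the intermediate value theorem will need it there. *)
Lemma continuous_double_rate x : 0 <= x -> {within `[0, x], continuous double_rate}.
Proof.
move=> x0 y.
have cid : {within `[0, x], continuous (@id R)} by apply: continuous_subspaceT => z; exact: cvg_id.
have cL := parameterized_integral_continuous x0 (integrable_intensity x).
have cG := parameterized_integral_continuous x0 (integrable_first_moment x).
exact: (continuousB (continuousM (cid y) (cL y)) (cG y)).
Qed.

Hypothesis h_infty :
  (\int[lebesgue_measure]_(y in `[0%R, +oo[) (h y)%:E = +oo)%E.

(** Monotone convergence gives divergence along the integers, and monotonicity of the rate extends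
    it to the reals. *)
Lemma arrival_rate_cvgy : arrival_rate h x @[x --> +oo] --> +oo.
Proof.
have cvgn : (\int[leb]_(y in `[0%R, n%:R]) (h y)%:E)%E @[n --> \oo] --> +oo%E.
  rewrite -h_infty (itv_bndy_bigcup_BRight true 0).
  under eq_bigcupr do rewrite add0r.
  apply: ge0_nondecreasing_set_cvg_integral => //.
  - by move=> m n mn; rewrite subsetEset; apply: subset_itvl; rewrite bnd_simp ler_nat.
  - by move=> n; case/integrableP : (integrable_intensity n%:R).
  - by move=> n x /=; rewrite in_itv/= lee_fin => /andP[/h_ge0].
apply/cvgryPge => A; have [n _ /(_ n (leqnn n))/= An] := (cvgeyPge _).1 cvgn A.
near=> x; apply: (@le_trans _ _ (arrival_rate h n%:R)).
  by rewrite -lee_fin fineK//; exact/integrable_fin_num/integrable_intensity.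
by apply: arrival_rate_nondecreasing; near: x; apply: nbhs_pinfty_ge; exact: num_real.
Unshelve. all: by end_near. Qed.

End intensity.

(** * Asymptotics of the arrival rate against its antiderivative *)

Section asymptotics.
Context {R : realType}.
Variable h : R -> R.
Hypothesis h_int : intensity h.
Hypothesis h_infty :
  (\int[lebesgue_measure]_(y in `[0%R, +oo[) (h y)%:E = +oo)%E.
Hypothesis h_diff : \forall x \near +oo, derivable h (x : R) 1.

Local Notation Lam := (arrival_rate h).
Local Notation Phi := (double_rate h).

Let near_pos : \forall x \near +oo, 0 < (x : R).
Proof. by apply: nbhs_pinfty_gt; exact: num_real. Qed.

Let h_cont : \forall x \near +oo, {for (x : R), continuous h}.
Proof.
by apply: filterS h_diff => x hx; apply/differentiable_continuous/derivable1_diffP.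
Qed.

Let is_derive_h : \forall x \near +oo, is_derive (x : R) 1 h (h^`()%classic x).
Proof. by apply: filterS h_diff => x hx; rewrite derive1E; exact/derivableP. Qed.

Let is_derive_Lam : \forall x \near +oo, is_derive (x : R) 1 Lam (h x).
Proof.
by near=> x; apply: is_derive_arrival_rate => //; near: x.
Unshelve. all: by end_near. Qed.

Let is_derive_Phi : \forall x \near +oo, is_derive (x : R) 1 Phi (Lam x).
Proof.
by near=> x; apply: is_derive_double_rate => //; near: x.
Unshelve. all: by end_near. Qed.

(** The derivative [Lam] eventually exceeds [K + 1]; the extra unit of slope pays for the constant
    of integration. *)
Lemma double_rate_superlinear K : \forall x \near +oo, K * x <= Phi x.
Proof.
have [||C HC] := @derive_le_near R (fun x => (K + 1) * x) Phi (fun=> K + 1) Lam _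
  is_derive_Phi.
- near=> x; have dx := is_deriveZ (K + 1) (is_derive_id x (1 : R)).
  by apply: (is_derive_eq dx); rewrite -[_ *: _]/(_ * _) mulr1.
- exact: (cvgryPge _).1 (arrival_rate_cvgy _ h_int h_infty) _.
near=> x; have : (K + 1) * x <= Phi x + C by near: x.
have : C <= x by near: x; apply: nbhs_pinfty_ge; exact: num_real.
by rewrite mulrDl mul1r; lra.
Unshelve. all: by end_near. Qed.

Lemma double_rate_dominates_affine C D (e : R) : 0 < e ->
  \forall x \near +oo, C * x + D <= e * Phi x.
Proof.
move=> e0; near=> x.
(* Once [x >= 1], [D] is at most [|D| * x], so this slope covers both terms. *)
have KP : (`|C| + `|D|) / e * x <= Phi x by near: x; exact: double_rate_superlinear.
have x1 : 1 <= x by near: x; apply: nbhs_pinfty_ge; exact: num_real.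
rewrite -(ler_pM2l e0) mulrA mulrCA divff ?gt_eqF// mulr1 in KP.
apply: le_trans KP; rewrite mulrDl lerD//.
  by rewrite ler_wpM2r ?ler_norm//; lra.
by rewrite (le_trans (ler_norm D))// ler_peMr.
Unshelve. all: by end_near. Qed.

(** Two integrations. From [(x h)' = h + x h' <= (1 + b) h] comes [x h <= (1 + b) Lam + C]; then
    [(x Lam)' = Lam + x h] gives [x Lam <= (2 + b) Phi + C x + D], and [e * Phi] absorbs the affine
    remainder. *)
Lemma mul_rate_le (b e : R) : 0 < e ->
  (\forall x \near +oo, x * h^`()%classic x <= b * h x) ->
  \forall x \near +oo, x * Lam x <= (2 + b + e) * Phi x.
Proof.
move=> e0 hb.
have [|||C HC] := @derive_le_near R (fun x => x * h x) (fun x => (1 + b) * Lam x)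
  (fun x => h x + x * h^`()%classic x) (fun x => (1 + b) * h x).
- near=> x; have dh : is_derive x 1 h (h^`()%classic x) by near: x.
  apply: (is_derive_eq (is_deriveM (is_derive_id x (1 : R)) dh)).
  by rewrite -[x *: _]/(x * _) -[h x *: 1]/(h x * 1); ring.
- by near=> x; apply: (@is_deriveZ _ _ _ Lam); near: x.
- near=> x; have : x * h^`()%classic x <= b * h x by near: x.
  by rewrite mulrDl mul1r; lra.
have [|||D HD] := @derive_le_near R (fun x => x * Lam x)
  (fun x => (2 + b) * Phi x + C * x)
  (fun x => Lam x + x * h x) (fun x => (2 + b) * Lam x + C).
- near=> x; have dL : is_derive x 1 Lam (h x) by near: x.
  apply: (is_derive_eq (is_deriveM (is_derive_id x (1 : R)) dL)).
  by rewrite -[x *: _]/(x * _) -[Lam x *: 1]/(Lam x * 1); ring.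
- near=> x; have dP : is_derive x 1 Phi (Lam x) by near: x.
  apply: (is_derive_eq (is_deriveD (is_deriveZ (2 + b) dP)
    (is_deriveZ C (is_derive_id x (1 : R))))).
  by rewrite -[C *: 1]/(C * 1) mulr1.
- by near=> x; have : x * h x <= (1 + b) * Lam x + C by [near: x]; nra.
near=> x; rewrite mulrDl.
have : C * x + D <= e * Phi x by near: x; exact: double_rate_dominates_affine.
by have : x * Lam x <= (2 + b) * Phi x + C * x + D by [near: x]; lra.
Unshelve. all: by end_near. Qed.

(** The same two integrations with the inequalities reversed. *)
Lemma mul_rate_ge (a e : R) : 0 < e ->
  (\forall x \near +oo, a * h x <= x * h^`()%classic x) ->
  \forall x \near +oo, (2 + a - e) * Phi x <= x * Lam x.
Proof.
move=> e0 hb.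
have [|||C HC] := @derive_le_near R (fun x => (1 + a) * Lam x) (fun x => x * h x)
  (fun x => (1 + a) * h x) (fun x => h x + x * h^`()%classic x).
- by near=> x; apply: (@is_deriveZ _ _ _ Lam); near: x.
- near=> x; have dh : is_derive x 1 h (h^`()%classic x) by near: x.
  apply: (is_derive_eq (is_deriveM (is_derive_id x (1 : R)) dh)).
  by rewrite -[x *: _]/(x * _) -[h x *: 1]/(h x * 1); ring.
- near=> x; have : a * h x <= x * h^`()%classic x by near: x.
  by rewrite mulrDl mul1r; lra.
have [|||D HD] := @derive_le_near R (fun x => (2 + a) * Phi x - C * x)
  (fun x => x * Lam x) (fun x => (2 + a) * Lam x - C) (fun x => Lam x + x * h x).
- near=> x; have dP : is_derive x 1 Phi (Lam x) by near: x.
  apply: (is_derive_eq (is_deriveB (is_deriveZ (2 + a) dP)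
    (is_deriveZ C (is_derive_id x (1 : R))))).
  by rewrite -[C *: 1]/(C * 1) mulr1.
- near=> x; have dL : is_derive x 1 Lam (h x) by near: x.
  apply: (is_derive_eq (is_deriveM (is_derive_id x (1 : R)) dL)).
  by rewrite -[x *: _]/(x * _) -[Lam x *: 1]/(Lam x * 1); ring.
- by near=> x; have : (1 + a) * Lam x <= x * h x + C by [near: x]; nra.
near=> x; rewrite mulrBl.
have : C * x + D <= e * Phi x by near: x; exact: double_rate_dominates_affine.
by have : (2 + a) * Phi x - C * x <= x * Lam x + D by [near: x]; lra.
Unshelve. all: by end_near. Qed.

Hypothesis h_neq0 : \forall x \near +oo, h x != 0.

Let h_gt0 : \forall x \near +oo, 0 < h x.
Proof.
near=> x; rewrite lt_neqAle eq_sym; apply/andP; split; first by near: x.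
by case: h_int => _ + _; apply; near: x; apply: nbhs_pinfty_ge; exact: num_real.
Unshelve. all: by end_near. Qed.

Let Phi_gt0 : \forall x \near +oo, 0 < Phi x.
Proof.
near=> x; apply: (@lt_le_trans _ _ (1 * x)); first by rewrite mul1r; near: x.
by near: x; exact: double_rate_superlinear.
Unshelve. all: by end_near. Qed.

Lemma elasticity_le_near l (b : R) :
  (x * h^`()%classic x / h x)%:E @[x --> +oo] --> l -> (l < b%:E)%E ->
  \forall x \near +oo, x * h^`()%classic x <= b * h x.
Proof.
move=> hl lb; near=> x; rewrite -ler_pdivrMr; last by near: x.
by near: x; exact: cvg_ereal_le_near hl lb.
Unshelve. all: by end_near. Qed.

Lemma elasticity_ge_near l (a : R) :
  (x * h^`()%classic x / h x)%:E @[x --> +oo] --> l -> (a%:E < l)%E ->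
  \forall x \near +oo, a * h x <= x * h^`()%classic x.
Proof.
move=> hl lb; near=> x; rewrite -ler_pdivlMr; last by near: x.
by near: x; exact: cvg_ereal_ge_near hl lb.
Unshelve. all: by end_near. Qed.

Lemma cvg_rate_quotient l (m : R) : 0 < m ->
  (x * h^`()%classic x / h x)%:E @[x --> +oo] --> l ->
  (x * (m + Lam x) / Phi x)%:E @[x --> +oo] --> (l + 2%:E)%E.
Proof.
move=> m0 hl; apply: cvg_ereal_order => b.
- rewrite -lteBrDr// -EFinB => /ereal_between[c lc cb].
  (* Half of the gap between [c] and [b - 2] goes to the error of [mul_rate_le], the other half to
     [m * x]. *)
  have e0 : 0 < (b - 2 - c) / 2 by lra.
  have := mul_rate_le _ _ e0 (elasticity_le_near _ _ hl lc).
  move=> HL; near=> x; rewrite ler_pdivrMr; last by near: x.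
  have : x * Lam x <= (2 + c + (b - 2 - c) / 2) * Phi x by near: x.
  have : m * x + 0 <= (b - 2 - c) / 2 * Phi x.
    by near: x; exact: double_rate_dominates_affine.
  have -> : b = 2 + c + (b - 2 - c) / 2 + (b - 2 - c) / 2 by lra.
  by rewrite mulrDl; lra.
- rewrite -lteBlDr// -EFinB => /ereal_between'[c cl bc].
  have e0 : 0 < c - (b - 2) by lra.
  have := mul_rate_ge _ _ e0 (elasticity_ge_near _ _ hl cl).
  move=> HL; near=> x; rewrite ler_pdivlMr; last by near: x.
  have : (2 + c - (c - (b - 2))) * Phi x <= x * Lam x by near: x.
  have -> : 2 + c - (c - (b - 2)) = b by ring.
  have : 0 <= m * x by rewrite mulr_ge0 ?ltW//; near: x.
  by lra.
Unshelve. all: by end_near. Qed.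

End asymptotics.

(** * The optimal threshold and the limit of the price of anarchy *)

Section price_of_anarchy.
Context {R : realType}.
Variables (mu ct : R) (h : R -> R).
Hypotheses (mu_gt0 : 0 < mu) (ct_gt0 : 0 < ct) (h_int : intensity h).

Lemma is_opt_thresholdE xe x : is_opt_threshold mu h xe x <->
  0 <= x /\ xe = mu^-1 * double_rate h x + x.
Proof. by rewrite /is_opt_threshold (Rintegral_affine_intensity _ h_int). Qed.

(** The intermediate value theorem on [[0, xe]] provides a threshold, since [V 0 = 0] and
    [V xe >= xe]; hence [xget] does not fall back on its default. *)
Lemma opt_thresholdP xe : 0 <= xe ->
  is_opt_threshold mu h xe (opt_threshold mu h xe).
Proof.
move=> xe0; apply: (@xgetPex _ _ [set x | is_opt_threshold mu h xe x]).
pose V x := mu^-1 * double_rate h x + x.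
have cV : {within `[0, xe], continuous V}.
  move=> y; have cid : {within `[0, xe], continuous (@id R)}.
    by apply: continuous_subspaceT => z; exact: cvg_id.
  have cc : {within `[0, xe], continuous (fun=> mu^-1 : R)}.
    by apply: continuous_subspaceT => z; exact: cvg_cst.
  have cP := continuous_double_rate _ h_int _ xe0.
  exact: (continuousD (continuousM (cc y) (cP y)) (cid y)).
have V0 : V 0 = 0.
  rewrite /V /double_rate /first_moment mul0r sub0r set_itv1.
  by rewrite Rintegral_set1 oppr0 mulr0 addr0.
have Vxe : xe <= V xe.
  by rewrite /V lerDr mulr_ge0 ?invr_ge0 ?(ltW mu_gt0)//; exact: double_rate_ge0.
have [|x] := @IVT _ V 0 xe xe xe0 cV.
  by rewrite V0 (min_idPl _) ?(max_idPr _) ?xe0 ?Vxe// (le_trans xe0).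
rewrite in_itv/= => /andP[x0 _] <-.
by exists x; apply/is_opt_thresholdE.
Qed.

Lemma PoAE xe : 0 <= xe -> 0 < double_rate h xe ->
  PoA mu ct h xe = (xe - opt_threshold mu h xe)
                   * (mu + arrival_rate h xe) / double_rate h xe.
Proof.
move=> xe0 P0; have /is_opt_thresholdE[] := opt_thresholdP _ xe0.
rewrite /PoA /social_benefit !(Rintegral_affine_intensity _ h_int) -/(double_rate h xe).
set x := opt_threshold _ _ _; rewrite /double_rate => x0 xeE.
have L0 := arrival_rate_ge0 _ h_int x; have L1 := arrival_rate_ge0 _ h_int xe.
(* The threshold equation solved for the first moment. The integral in the benefit at [x] becomes
   [(xe - x) * (mu + arrival_rate h x)], whose second factor cancels against the denominator. *)
have GE : first_moment h x = x * arrival_rate h x - mu * (xe - x).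
  by rewrite [in RHS]xeE; field; rewrite gt_eqF.
rewrite -/(double_rate h xe) GE.
have [Lx Lxe] : 0 < mu + arrival_rate h x /\ 0 < mu + arrival_rate h xe.
  by split; exact: ltr_wpDr.
by field; rewrite !gt_eqF.
Qed.

Hypothesis h_infty :
  (\int[lebesgue_measure]_(y in `[0%R, +oo[) (h y)%:E = +oo)%E.
Hypothesis h_diff : \forall x \near +oo, derivable h (x : R) 1.

Lemma opt_threshold_small (e : R) : 0 < e ->
  \forall xe \near +oo, opt_threshold mu h xe <= e * xe.
Proof.
move=> e0.
(* Beyond [N], this slope makes the term [mu^-1 * double_rate h x] of the threshold equation at
   least [x / e]. A threshold of at most [N] is small because [xe >= N / e]. *)
have [N [_ HN]] := double_rate_superlinear _ h_int h_infty h_diff (mu / e).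
near=> xe.
have xe0 : 0 <= xe by near: xe; apply: nbhs_pinfty_ge; exact: num_real.
have /is_opt_thresholdE[] := opt_thresholdP _ xe0.
set x := opt_threshold _ _ _ => x0 xeE.
have [/HN Nx|xN] := ltP N x; last first.
  apply: (le_trans xN); rewrite mulrC -(ler_pdivrMr _ _ e0).
  by near: xe; apply: nbhs_pinfty_ge; exact: num_real.
rewrite mulrC -ler_pdivrMr// xeE; apply: (@le_trans _ _ (mu^-1 * double_rate h x)).
  by rewrite ler_pdivlMl// mulrCA mulrC.
by rewrite lerDl.
Unshelve. all: by end_near. Qed.

Hypothesis h_neq0 : \forall x \near +oo, h x != 0.

Lemma cvg_PoA (l : \bar R) :
  (x * h^`()%classic x / h x)%:E @[x --> +oo] --> l ->
  (PoA mu ct h xe)%:E @[xe --> +oo] --> (l + 2%:E)%E.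
Proof.
move=> hl; have := cvg_rate_quotient _ h_int h_infty h_diff h_neq0 _ _ mu_gt0 hl.
have c1 : ((xe - opt_threshold mu h xe) / xe)%:E @[xe --> +oo] --> 1%:E.
  apply: cvg_EFin; first exact: nearW.
  apply/cvgrPdist_le => e e0; near=> xe.
  have xe0 : 0 < xe by near: xe; apply: nbhs_pinfty_gt; exact: num_real.
  have /is_opt_thresholdE[x0 _] := opt_thresholdP _ (ltW xe0).
  rewrite /= mulrBl divff ?gt_eqF// opprB addrCA subrr addr0.
  rewrite ger0_norm ?divr_ge0 ?(ltW xe0)// ler_pdivrMr//.
  by near: xe; exact: opt_threshold_small.
(* The product of limits is defined even for infinite [l], as the first factor is finite and
   nonzero. *)
have md : (1%:E *? (l + 2%:E))%E
  by rewrite mule_defE eqe oner_eq0 /= andbF.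
move=> /(cvgeM md c1); rewrite mul1e; apply: cvg_trans; apply: near_eq_cvg.
near=> xe.
have xe0 : 0 < xe by near: xe; apply: nbhs_pinfty_gt; exact: num_real.
have P0 : 0 < double_rate h xe.
  apply: (@lt_le_trans _ _ (1 * xe)); first by rewrite mul1r.
  by near: xe; exact: double_rate_superlinear.
rewrite PoAE ?(ltW xe0)// -EFinM; congr (_%:E).
by field; rewrite !gt_eqF.
Unshelve. all: by end_near. Qed.

End price_of_anarchy.

(** * Pointwise order of intensities implies order of their elasticity limits *)

Section comparison.
Context {R : realType}.
Implicit Types h : R -> R.

Lemma elasticity_le h1 h2 (l1 l2 : \bar R) :
  (\forall x \near +oo, derivable h1 (x : R) 1) ->
  (\forall x \near +oo, derivable h2 (x : R) 1) ->
  (\forall x \near +oo, 0 < h1 x <= h2 x) ->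
  (x * h1^`()%classic x / h1 x)%:E @[x --> +oo] --> l1 ->
  (x * h2^`()%classic x / h2 x)%:E @[x --> +oo] --> l2 ->
  (l1 <= l2)%E.
Proof.
move=> dh1 dh2 h12 hl1 hl2; rewrite leNgt; apply/negP => l21.
(* Reals [a < b] strictly between [l2] and [l1] are wanted; [b - a] is then the coefficient of
   [ln x]. *)
have [a l1a l2a] : exists2 a : R, (a%:E < l1)%E & (l2 < a%:E)%E.
  case: l2 l21 {hl2} => [r||] l21; last 2 first.
  - by rewrite ltNge leey in l21.
  - case: l1 l21 {hl1} => [s||//] _; [exists (s - 1)|exists 0];
      by rewrite ?lte_fin ?ltry ?ltNyr//; lra.
  case: (ereal_between' _ _ l21) => c cl1 rc.
  by exists c; rewrite ?lte_fin.
have [b l1b ab] := ereal_between' _ _ l1a.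
have el1 : \forall x \near +oo, b <= x * h1^`()%classic x / h1 x.
  exact: cvg_ereal_ge_near hl1 l1b.
have el2 : \forall x \near +oo, x * h2^`()%classic x / h2 x <= a.
  exact: cvg_ereal_le_near hl2 l2a.
have [|||C HC] := @derive_le_near R (fun x => (b - a) * ln x + ln (h2 x))
  (fun x => ln (h1 x))
  (fun x => (b - a) * x^-1 + (h2 x)^-1 * h2^`()%classic x)
  (fun x => (h1 x)^-1 * h1^`()%classic x).
- near=> x.
  have x0 : 0 < x by near: x; apply: nbhs_pinfty_gt; exact: num_real.
  have /andP[h10 h12x] : 0 < h1 x <= h2 x by near: x.
  have dl := is_derive1_ln x0.
  have dh : is_derive x 1 h2 (h2^`()%classic x).
    by rewrite derive1E; apply/derivableP; near: x.
  have dlh := is_derive1_comp (is_derive1_ln (lt_le_trans h10 h12x)) dh.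
  exact: (is_deriveD (is_deriveZ (b - a) dl) dlh).
- near=> x.
  have /andP[h10 _] : 0 < h1 x <= h2 x by near: x.
  have dh : is_derive x 1 h1 (h1^`()%classic x).
    by rewrite derive1E; apply/derivableP; near: x.
  exact: (is_derive1_comp (is_derive1_ln h10) dh).
- near=> x.
  have x0 : 0 < x by near: x; apply: nbhs_pinfty_gt; exact: num_real.
  (* Multiplying by [x] turns the logarithmic derivatives into elasticities, and the claim into
     [b - a] plus that of [h2] being at most that of [h1]. *)
  rewrite -(ler_pM2l x0) mulrDr mulrCA divff ?gt_eqF// mulr1.
  have : b <= x * h1^`()%classic x / h1 x by near: x.
  have : x * h2^`()%classic x / h2 x <= a by near: x.
  by rewrite ![_^-1 * _]mulrC !mulrA; lra.
near +oo_R => x.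
have /andP[h10 h12x] : 0 < h1 x <= h2 x by near: x.
have : ln (h1 x) <= ln (h2 x) by rewrite ler_ln ?posrE// (lt_le_trans h10).
have : (b - a) * ln x + ln (h2 x) <= ln (h1 x) + C by near: x.
suff : C < (b - a) * ln x by lra.
have x0 : 0 < x by near: x; apply: nbhs_pinfty_gt; exact: num_real.
(* Past this point [(b - a) * ln x] exceeds [C], contradicting [ln (h1 x) <= ln (h2 x)]. *)
have Cx : expR (C / (b - a)) < x.
  by near: x; apply: nbhs_pinfty_gt; exact: num_real.
by rewrite mulrC -ltr_pdivrMr ?subr_gt0// -ltr_expR lnK.
Unshelve. all: by end_near. Qed.

End comparison.

Theorem theorem3p19 (R : realType) (mu ct : R) (h1 h2 : R -> R)
    (mu_gt0 : 0 < mu) (ct_gt0 : 0 < ct)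
    (h1_int : intensity h1) (h2_int : intensity h2)
    (h1_infty : (\int[lebesgue_measure]_(y in `[0%R, +oo[) (h1 y)%:E = +oo)%E)
    (h2_infty : (\int[lebesgue_measure]_(y in `[0%R, +oo[) (h2 y)%:E = +oo)%E)
    (h1_lim : has_elasticity_limit h1) (h2_lim : has_elasticity_limit h2)
    (h12 : exists M : R, [/\ 0 < M,
       monotonic_from M h1, monotonic_from M h2 &
       forall x, M <= x -> h1 x <= h2 x]) :
  exists l1 l2 : \bar R,
    [/\ (PoA mu ct h1 xe)%:E @[xe --> +oo] --> l1,
        (PoA mu ct h2 xe)%:E @[xe --> +oo] --> l2 &
        (l1 <= l2)%E].
Proof.
case: h1_lim => h1_reg [l1 hl1]; case: h2_lim => h2_reg [l2 hl2].
have dh1 : \forall x \near +oo, derivable h1 (x : R) 1 by apply: filterS h1_reg => x [].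
have dh2 : \forall x \near +oo, derivable h2 (x : R) 1 by apply: filterS h2_reg => x [].
have h1_neq0 : \forall x \near +oo, h1 x != 0 by apply: filterS h1_reg => x [].
have h2_neq0 : \forall x \near +oo, h2 x != 0 by apply: filterS h2_reg => x [].
exists (l1 + 2%:E)%E, (l2 + 2%:E)%E; split; [exact: cvg_PoA..|].
apply: leeD2r; apply: (elasticity_le _ _ _ _ dh1 dh2 _ hl1 hl2).
(* The logarithms in [elasticity_le] need [h1] eventually positive, which follows from its being
   nonnegative and eventually nonzero. *)
case: h12 => M [_ _ _ h12]; near=> x; apply/andP; split.
  rewrite lt_neqAle eq_sym; apply/andP; split; first by near: x.
  by case: h1_int => _ + _; apply; near: x; apply: nbhs_pinfty_ge; exact: num_real.
by apply: h12; near: x; apply: nbhs_pinfty_ge; exact: num_real.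
Unshelve. all: by end_near. Qed.
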